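(* Let $(M,g)$ be a Riemannian manifold, let $S^n\subset\mathbb{R}^{n+1}$ be the unit sphere with its round metric, and let $\delta_1,\delta_2\in\mathbb{R}$. Suppose that $\varphi\colon M\to S^n\subset\mathbb{R}^{n+1}$ is a smooth solution of $$\delta_2\Big(\Delta^2\varphi+\big(|\Delta\varphi|^2+\Delta|d\varphi|^2+2\langle d\varphi,\nabla\Delta\varphi\rangle+2|d\varphi|^4\big)\varphi+2\nabla(|d\varphi|^2d\varphi)\Big)=\delta_1\big(\Delta\varphi+|d\varphi|^2\varphi\big).$$ Then the following conservation law holds: $$\nabla\Big(\delta_2\big(\nabla\Delta\varphi\wedge\varphi-\Delta\varphi\wedge\nabla\varphi+2|d\varphi|^2\nabla\varphi\wedge\varphi\big)-\delta_1\nabla\varphi\wedge\varphi\Big)=0,$$ which (if $\delta_2\neq 0$) can also be written in the form $$\Delta\big(\nabla(\nabla\varphi\wedge\varphi)\big)=\nabla\Big(2\Delta\varphi\wedge\nabla\varphi-2|d\varphi|^2\nabla\varphi\wedge\varphi+\frac{\delta_1}{\delta_2}\nabla\varphi\wedge\varphi\Big).$$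
   Context: The map $\varphi$ is regarded as an $\mathbb{R}^{n+1}$-valued function on $M$ with $|\varphi|=1$; $\Delta=\operatorname{div}\operatorname{grad}$ is the Laplace operator on functions on $M$ acting componentwise, and $\langle d\varphi,\nabla\Delta\varphi\rangle=\sum_i\langle\nabla_{e_i}\varphi,\nabla_{e_i}\Delta\varphi\rangle$ for a local orthonormal frame $\{e_i\}$ of $TM$. The symbol $\wedge$ denotes the exterior product of vectors in $\mathbb{R}^{n+1}$, so e.g. $\nabla\varphi\wedge\varphi$ is the $\Lambda^2\mathbb{R}^{n+1}$-valued one-form $e_i\mapsto\nabla_{e_i}\varphi\wedge\varphi$, and $\Delta\varphi\wedge\nabla\varphi$ is the one-form $e_i\mapsto\Delta\varphi\wedge\nabla_{e_i}\varphi$. When $\nabla$ is applied to a (vector-valued) one-form $\omega$ it means the divergence $\sum_i(\nabla_{e_i}\omega)(e_i)$. *)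

(* Defs.v *)
From HB Require Import structures.
From mathcomp Require Import all_boot all_order all_algebra.
From mathcomp Require Import all_classical all_reals all_analysis.

Set Implicit Arguments.
Unset Strict Implicit.
Unset Printing Implicit Defensive.

Import Order.TTheory GRing.Theory Num.Theory.
Import numFieldNormedType.Exports.

Local Open Scope classical_set_scope.
Local Open Scope ring_scope.

(* C^k on an open set D.  In finite dimension, f is C^(k+1) iff it is
   differentiable with all its directional derivatives of class C^k. *)
Fixpoint Ck (R : realType) (V W : normedModType R) (k : nat) (D : set V)
    (f : V -> W) : Prop :=
  match k with
  | 0%N => forall x, D x -> {for x, continuous f}
  | k'.+1 => (forall x, D x -> differentiable f x) /\
             (forall v, Ck k' D (fun x => 'D_v f x))
  end.

Definition smooth_on (R : realType) (V W : normedModType R) (D : set V)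
  (f : V -> W) : Prop := forall k, Ck k D f.

(* A smooth m-manifold with a Riemannian metric, presented by an atlas.  The
   chart c is a homeomorphism [chart c], with inverse [chart_inv c], from the
   open set [dom c] onto an open subset of R^m; outside these sets the values
   are irrelevant.  [metric c p] is the Gram matrix (g_ij(p)) of the metric in
   the coordinate basis of T_pM given by c.  Coordinates are row vectors, so
   that the (i, a) entry of 'J (chart d \o chart_inv c) is dy^a / dx^i, where x
   and y are the coordinates of c and d. *)
Record riemannian_manifold (R : realType) (m : nat) := RiemannianManifold {
  carrier :> topologicalType ;
  atlas : Type ;
  dom : atlas -> set carrier ;
  chart : atlas -> carrier -> 'rV[R]_m ;
  chart_inv : atlas -> 'rV[R]_m -> carrier ;
  metric : atlas -> carrier -> 'M[R]_m ;
  manifold_hausdorff : hausdorff_space carrier ;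
  manifold_second_countable : @second_countable carrier ;
  dom_open : forall c, open (dom c) ;
  dom_cover : forall p, exists c, dom c p ;
  chart_open : forall c, open (chart c @` dom c) ;
  chartK : forall c p, dom c p -> chart_inv c (chart c p) = p ;
  chart_continuous : forall c p, dom c p -> {for p, continuous (chart c)} ;
  chart_inv_continuous : forall c x, (chart c @` dom c) x ->
    {for x, continuous (chart_inv c)} ;
  transition_smooth : forall c d,
    smooth_on (chart c @` (dom c `&` dom d)) (chart d \o chart_inv c) ;
  metric_smooth : forall c,
    smooth_on (chart c @` dom c) (metric c \o chart_inv c) ;
  metric_sym : forall c p, dom c p -> (metric c p)^T = metric c p ;
  metric_pos : forall c p, dom c p -> forall v : 'rV[R]_m, v != 0 ->
    0 < (v *m metric c p *m v^T) ord0 ord0 ;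
  metric_change : forall c d p, dom c p -> dom d p ->
    let J := 'J (chart d \o chart_inv c) (chart c p) in
    metric c p = J *m metric d p *m J^T
}.

Arguments metric {R m _} c p.
Arguments dom {R m _} c.
Arguments chart {R m _} c p.
Arguments chart_inv {R m _} c x.

Definition smooth_map (R : realType) (m : nat) (M : riemannian_manifold R m)
    (W : normedModType R) (f : M -> W) : Prop :=
  forall c : atlas M, smooth_on (chart c @` dom c) (f \o chart_inv c).

(* Tensor calculus in the coordinates of a chart c.  Functions live on M;
   one-forms and vector fields, with values in W, are given by their components
   in the coordinate (co)basis of c.  Every operator below is meaningful on
   [dom c] and is the coordinate expression there of the intrinsic one. *)
Section Calculus.
Variables (R : realType) (m : nat) (M : riemannian_manifold R m) (c : atlas M).

Definition pd (W : normedModType R) (i : 'I_m) (f : M -> W) (p : M) : W :=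
  'D_(delta_mx ord0 i) (f \o chart_inv c) (chart c p).

Definition invmetric (p : M) : 'M[R]_m := invmx (metric c p).

(* Christoffel symbol Gamma^k_ij of the Levi-Civita connection. *)
Definition christoffel (k i j : 'I_m) (p : M) : R :=
  2^-1 * \sum_l invmetric p k l *
    (pd i (fun q => metric c q j l : R^o) p
     + pd j (fun q => metric c q i l : R^o) p
     - pd l (fun q => metric c q i j : R^o) p).

(* Metric trace of a bilinear form; it is sum_a B(e_a, e_a) for every
   orthonormal basis (e_a) of T_pM, see [metric_trace_orthonormal]. *)
Definition metric_trace (W : lmodType R) (B : 'I_m -> 'I_m -> W) (p : M) : W :=
  \sum_i \sum_j invmetric p i j *: B i j.

(* (nabla_i w)_j *)
Definition nabla1 (W : normedModType R) (w : 'I_m -> M -> W) (i j : 'I_m)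
    (p : M) : W :=
  pd i (w j) p - \sum_k christoffel k i j p *: w k p.

Definition div1 (W : normedModType R) (w : 'I_m -> M -> W) (p : M) : W :=
  metric_trace (fun i j => nabla1 w i j p) p.

Definition grad (W : normedModType R) (f : M -> W) (i : 'I_m) (p : M) : W :=
  \sum_j invmetric p i j *: pd j f p.

(* Trace of the covariant derivative of a vector field. *)
Definition divv (W : normedModType R) (X : 'I_m -> M -> W) (p : M) : W :=
  \sum_i (pd i (X i) p + \sum_k christoffel i i k p *: X k p).

Definition laplacian (W : normedModType R) (f : M -> W) : M -> W :=
  divv (grad f).

Definition dotv (N : nat) (u v : 'rV[R]_N) : R := \sum_k u ord0 k * v ord0 k.

Definition inner_d (N : nat) (f h : M -> 'rV[R]_N) (p : M) : R :=
  metric_trace (fun i j => dotv (pd i f p) (pd j h p) : R^o) p.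

Definition sqnorm_d (N : nat) (f : M -> 'rV[R]_N) (p : M) : R := inner_d f f p.

(* The exterior product in Lambda^2 R^N, realized as the space of
   skew-symmetric matrices, with e_a /\ e_b = E_ab - E_ba. *)
Definition wedge (N : nat) (u v : 'rV[R]_N) : 'M[R]_N := u^T *m v - v^T *m u.

Lemma metric_trace_orthonormal (W : lmodType R) (B : 'I_m -> 'I_m -> W) (p : M)
    (E : 'M[R]_m) : E *m metric c p *m E^T = 1%:M ->
  metric_trace B p = \sum_a \sum_i \sum_j (E a i * E a j) *: B i j.
Proof.
move=> EgE.
have gEE : metric c p *m (E^T *m E) = 1%:M.
  by apply: mulmx1C; rewrite -mulmxA; apply: mulmx1C.
have gu : metric c p \in unitmx by case: (mulmx1_unit gEE).
have -> : metric_trace B p = \sum_i \sum_j (E^T *m E) i j *: B i j.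
  by rewrite /metric_trace /invmetric -[E^T *m E](mulKmx gu) gEE mulmx1.
rewrite [RHS]exchange_big /=; apply: eq_bigr => i _.
rewrite [RHS]exchange_big /=; apply: eq_bigr => j _.
by rewrite mxE scaler_suml; apply: eq_bigr => a _; rewrite mxE.
Qed.

End Calculus.

(* Main.v *)
(* Every wedge product is bilinear, so the divergence of a one-form df /\ g obeys
   a Leibniz rule: it is (Delta f) /\ g plus the metric trace of
   (d_j f) /\ (d_i g).  With f, g = phi and L = Delta phi, the symmetry of the
   metric makes the traces cancel, and L /\ L = 0, so that
     div (dL /\ phi - L /\ dphi) = (Delta L) /\ phi,
     div (e dphi /\ phi) = (div (e dphi)) /\ phi,
     div (dphi /\ phi) = L /\ phi.
   Wedging the equation with phi kills all multiples of phi and leaves exactly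
   the conservation law.  The second form follows since
   Delta (div (dphi /\ phi)) = div d (L /\ phi) = div (dL /\ phi + L /\ dphi).
   The one fact about the Levi-Civita connection that is needed is that the
   Laplacian, defined as div grad, equals the metric trace of the covariant
   derivative of df. *)
Require Import Defs.
From HB Require Import structures.
From mathcomp Require Import all_boot all_order all_algebra.
From mathcomp Require Import all_classical all_reals all_analysis.
From mathcomp Require Import ring.

Set Implicit Arguments.
Unset Strict Implicit.
Unset Printing Implicit Defensive.

Import Order.TTheory GRing.Theory Num.Theory.
Import numFieldNormedType.Exports.

Local Open Scope classical_set_scope.
Local Open Scope ring_scope.

(** * Differentiability and [Ck] functions between normed modules *)

Section Differentiability.
Variable R : realType.
Implicit Types V W : normedModType R.

(** The zero linear map satisfies the first-order expansion exactly near [x], and [diff_unique]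
    identifies it with the differential. Through the difference [g - f] this makes differentiability
    a local property. *)
Lemma near0_differentiable V W (f : V -> W) (x : V) :
  (\near x, f x = 0) -> differentiable f x.
Proof.
move=> f0; apply/diff_locallyP.
have fx0 : f x = 0 by exact: nbhs_singleton f0.
have o0 : f \o shift x = cst (f x) + (\0 : {linear V -> W}) +o_ 0 id.
  apply/eqaddoP => _/posnumP[e]; near=> h.
  rewrite /= fctE /= /cst fx0 !addr0 subr0.
  rewrite (_ : f (h + x) = 0) ?normr0 ?mulr_ge0//.
  near: h; move: f0; rewrite (near_shift 0 x) /=.
  by apply: filterS => h; rewrite /= subr0.
have c0 : continuous (\0 : {linear V -> W}) by move=> ?; exact: cvg_cst.
by rewrite (diff_unique c0 o0).
Unshelve. all: by end_near. Qed.

Lemma near_eq_differentiable V W (f g : V -> W) (x : V) :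
  (\near x, f x = g x) -> differentiable f x -> differentiable g x.
Proof.
move=> fg df; rewrite (_ : g = f + (g - f)); last by rewrite addrC subrK.
apply: differentiableD => //; apply: near0_differentiable.
by apply: filterS fg => y fgy; rewrite /= fctE -[LHS]/(g y - f y) fgy subrr.
Qed.

Section Bilinear.
Variables (U V W X : normedModType R) (B : {bilinear U -> V -> W}).
Hypothesis Bc : continuous (fun p : U * V => B p.1 p.2).

Lemma differentiable_bilinear (f : X -> U) (g : X -> V) x :
  differentiable f x -> differentiable g x ->
  differentiable (fun y => B (f y) (g y)) x.
Proof.
move=> df dg.
apply: (@differentiable_comp _ _ _ _ (fun y => (f y, g y))
  (fun p : U * V => B p.1 p.2)); first exact: differentiable_pair.
exact: differentiable_bilin.
Qed.

Lemma derive_bilinear (f : X -> U) (g : X -> V) x v :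
  differentiable f x -> differentiable g x ->
  'D_v (fun y => B (f y) (g y)) x = B ('D_v f x) (g x) + B (f x) ('D_v g x).
Proof.
move=> df dg; rewrite !deriveE//; last exact: differentiable_bilinear.
rewrite (@diff_comp _ _ _ _ (fun y => (f y, g y))
  (fun p : U * V => B p.1 p.2)) //; first last.
- exact: differentiable_bilin.
- exact: differentiable_pair.
by rewrite /= diff_bilin // diff_pair //= addrC.
Qed.
End Bilinear.

Section Ck.
Variables (V : normedModType R) (D : set V).
Hypothesis oD : open D.

Lemma Ck_differentiable W k (f : V -> W) x :
  Ck k.+1 D f -> D x -> differentiable f x.
Proof. by case=> + _; apply. Qed.

Lemma CkS W k (f : V -> W) : Ck k.+1 D f -> Ck k D f.
Proof.
elim: k f => [|k IH] f [df Df].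
  by move=> x Dx; apply: differentiable_continuous; exact: df.
by split => // v; apply: IH; exact: Df.
Qed.

(** Since [D] is open, equality on [D] holds near each of its points and passes to derivatives. The
    closure lemmas below rest on this, as their derivative formulas are known only on [D]. *)
Lemma eq_Ck W k (f g : V -> W) : (forall x, D x -> f x = g x) ->
  Ck k D f -> Ck k D g.
Proof.
elim: k f g => [|k IH] f g fg.
  move=> Cf x Dx; have nfg : \near x, f x = g x.
    by apply: filterS (open_nbhs_nbhs (conj oD Dx)) => y; exact: fg.
  rewrite /prop_for /continuous_at -(fg _ Dx); apply: cvg_trans (Cf x Dx).
  exact: near_eq_cvg.
have nfg x : D x -> \near x, f x = g x.
  by move=> Dx; apply: filterS (open_nbhs_nbhs (conj oD Dx)) => y; exact: fg.
case=> df Cf; split => [x Dx|v].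
  exact: near_eq_differentiable (nfg _ Dx) (df _ Dx).
apply: IH (Cf v) => x Dx; exact: near_eq_derive (nfg _ Dx).
Qed.

Lemma Ck_cst W k (a : W) : Ck k D (cst a).
Proof.
elim: k a => [|k IH] a; first by move=> x _; exact: cst_continuous.
split => // v; apply: eq_Ck (IH 0) => x _.
by rewrite derive_cst.
Qed.

Lemma Ck_add W k (f g : V -> W) :
  Ck k D f -> Ck k D g -> Ck k D (fun x => f x + g x).
Proof.
elim: k f g => [|k IH] f g.
  by move=> Cf Cg x Dx; exact: cvgD (Cf x Dx) (Cg x Dx).
move=> [df Cf] [dg Cg]; split => [x Dx|v].
  by apply: (@differentiableD _ _ _ f g); [exact: df | exact: dg].
apply: eq_Ck (IH _ _ (Cf v) (Cg v)) => x Dx.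
by rewrite (@deriveD _ _ _ f g)//; apply: diff_derivable; [exact: df | exact: dg].
Qed.

(** The derivative is a sum of two bilinear terms of the same shape, each with one differentiated
    factor and one factor lowered by [CkS]; hence the induction over all pairs [f], [g]. *)
Lemma Ck_bilinear (U W X : normedModType R) (B : {bilinear U -> W -> X}) k
  (f : V -> U) (g : V -> W) :
  continuous (fun p : U * W => B p.1 p.2) ->
  Ck k D f -> Ck k D g -> Ck k D (fun x => B (f x) (g x)).
Proof.
move=> Bc; elim: k f g => [|k IH] f g Cf Cg.
  move=> x Dx; apply: (@continuous_comp _ _ _ (fun y => (f y, g y))
    (fun p : U * W => B p.1 p.2)); last exact: Bc.
  exact: cvg_pair (Cf x Dx) (Cg x Dx).
have [df C1f] := Cf; have [dg C1g] := Cg.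
split => [x Dx|v].
  by apply: differentiable_bilinear => //; [exact: df | exact: dg].
apply: (@eq_Ck _ _ (fun x => B ('D_v f x) (g x) + B (f x) ('D_v g x))) => [x Dx|].
  by rewrite derive_bilinear //; [exact: df | exact: dg].
by apply: Ck_add; apply: IH; [exact: C1f | exact: CkS | exact: CkS | exact: C1g].
Qed.

Lemma Ck_linear (W X : normedModType R) (L : {linear W -> X}) k (f : V -> W) :
  continuous L -> Ck k D f -> Ck k D (fun x => L (f x)).
Proof.
move=> Lc; elim: k f => [|k IH] f.
  by move=> Cf x Dx; apply: (@continuous_comp _ _ _ f L); [exact: Cf | exact: Lc].
move=> [df Cf]; have dL x : D x -> differentiable (L \o f) x.
  by move=> Dx; apply: differentiable_comp; [exact: df | exact: linear_differentiable].
split => // v; apply: eq_Ck (IH _ (Cf v)) => x Dx.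
rewrite !deriveE //; [|exact: dL|exact: df].
by rewrite (@diff_comp _ _ _ _ f L) ?diff_lin//; [exact: df | exact: linear_differentiable].
Qed.

End Ck.
End Differentiability.

(** * Scaling, exterior product and dot product as continuous bilinear maps *)

Section BilinearMaps.
Variable R : realType.

Lemma scaler_is_bilinear (W : normedModType R) : bilinear_for
  (GRing.Scale.Law.clone _ _ *:%R _) (GRing.Scale.Law.clone _ _ *:%R _)
  (@GRing.scale R W : R^o -> W -> W).
Proof.
split=> [v|u] a x y /=; first by rewrite scalerDl scalerA.
by rewrite scalerDr !scalerA mulrC.
Qed.

(** Scaling, [wedge] and [dotv] are each packed as bilinear maps, so that the same product rule and
    smoothness lemma serve all three. *)
Definition scale_bil (W : normedModType R) : {bilinear R^o -> W -> W} :=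
  HB.pack (@GRing.scale R W : R^o -> W -> W)
    (bilinear_isBilinear.Build R R^o W W _ _ (@GRing.scale R W : R^o -> W -> W)
      (@scaler_is_bilinear W)).

Lemma scale_bil_continuous (W : normedModType R) :
  continuous (fun p : R^o * W => scale_bil W p.1 p.2).
Proof. by move=> p; exact: (@scale_continuous R W p). Qed.

Lemma mx_coord_continuous (T : topologicalType) (m n : nat) (f : T -> 'M[R]_(m, n)) :
  (forall i j, continuous (fun x => f x i j : R^o)) -> continuous f.
Proof.
move=> fc x.
rewrite (_ : f = fun y => \sum_i \sum_j f y i j *: delta_mx i j); last first.
  by apply/funext => y; exact: matrix_sum_delta.
apply: cvg_big => [|i _]; first exact: add_continuous.
apply: cvg_big => [|j _]; first exact: add_continuous.
by apply: cvgZr_tmp; exact: fc.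
Qed.

Variable N : nat.

Lemma wedgeE (u v : 'rV[R]_N) i j :
  wedge u v i j = u ord0 i * v ord0 j - v ord0 i * u ord0 j.
Proof. by rewrite !mxE !big_ord_recl !big_ord0 !mxE !addr0. Qed.

Lemma wedgeC (u v : 'rV[R]_N) : wedge u v = - wedge v u.
Proof. by rewrite /wedge opprB. Qed.

Lemma wedgevv (u : 'rV[R]_N) : wedge u u = 0.
Proof. exact: subrr. Qed.

(** Linearity on the right is reduced to linearity on the left by antisymmetry. *)
Lemma wedge_is_bilinear : bilinear_for
  (GRing.Scale.Law.clone _ _ *:%R _) (GRing.Scale.Law.clone _ _ *:%R _)
  (@wedge R N).
Proof.
have wl a (x y v : 'rV[R]_N) :
    wedge (a *: x + y) v = a *: wedge x v + wedge y v.
  by apply/matrixP => i j; rewrite [RHS]mxE [in RHS]mxE !wedgeE !mxE; ring.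
split=> [v|u] a x y; first exact: wl.
by rewrite /= wedgeC wl (wedgeC x) (wedgeC y) scalerN -opprD opprK.
Qed.

Definition wedge_bil : {bilinear 'rV[R]_N -> 'rV[R]_N -> 'M[R]_N} :=
  HB.pack (@wedge R N)
    (bilinear_isBilinear.Build R _ _ _ _ _ (@wedge R N) wedge_is_bilinear).

Let cvg_fst_coord (p : 'rV[R]_N * 'rV[R]_N) k :
  (fun q : 'rV[R]_N * 'rV[R]_N => q.1 ord0 k : R) @ p --> (p.1 ord0 k : R).
Proof.
apply: (@continuous_comp _ _ _ fst (fun u : 'rV[R]_N => u ord0 k : R)).
  exact: cvg_fst.
exact: coord_continuous.
Qed.

Let cvg_snd_coord (p : 'rV[R]_N * 'rV[R]_N) k :
  (fun q : 'rV[R]_N * 'rV[R]_N => q.2 ord0 k : R) @ p --> (p.2 ord0 k : R).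
Proof.
apply: (@continuous_comp _ _ _ snd (fun u : 'rV[R]_N => u ord0 k : R)).
  exact: cvg_snd.
exact: coord_continuous.
Qed.

Lemma wedge_bil_continuous :
  continuous (fun p : 'rV[R]_N * 'rV[R]_N => wedge_bil p.1 p.2).
Proof.
apply: mx_coord_continuous => i j.
rewrite (_ : (fun x => _) = fun p : 'rV[R]_N * 'rV[R]_N =>
    p.1 ord0 i * p.2 ord0 j - p.2 ord0 i * p.1 ord0 j : R^o); last first.
  by apply/funext => q; exact: wedgeE.
move=> p; apply: cvgB; apply: cvgM; by [exact: cvg_fst_coord | exact: cvg_snd_coord].
Qed.

Lemma dotv_is_bilinear : bilinear_for
  (GRing.Scale.Law.clone _ _ *:%R _) (GRing.Scale.Law.clone _ _ *:%R _)
  (@dotv R N : _ -> _ -> R^o).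
Proof.
split=> [v|u] a x y; rewrite /= /dotv scaler_sumr -big_split;
  apply: eq_bigr => k _; rewrite !mxE /=.
  by rewrite mulrDl -mulrA.
by rewrite mulrDr mulrCA.
Qed.

Definition dotv_bil : {bilinear 'rV[R]_N -> 'rV[R]_N -> R^o} :=
  HB.pack (@dotv R N : _ -> _ -> R^o)
    (bilinear_isBilinear.Build R _ _ _ _ _ (@dotv R N : _ -> _ -> R^o)
      dotv_is_bilinear).

Lemma dotv_bil_continuous :
  continuous (fun p : 'rV[R]_N * 'rV[R]_N => dotv_bil p.1 p.2).
Proof.
move=> p; apply: cvg_big => [|k _]; first exact: add_continuous.
by apply: cvgM; [exact: cvg_fst_coord | exact: cvg_snd_coord].
Qed.

End BilinearMaps.

(** * Closure properties of smooth functions on an open set *)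

Section SmoothOn.
Variables (R : realType) (V : normedModType R) (D : set V).
Hypothesis oD : open D.
Implicit Types (U W X : normedModType R).

Lemma eq_smooth_on W (f g : V -> W) : (forall x, D x -> f x = g x) ->
  smooth_on D f -> smooth_on D g.
Proof. by move=> fg sf k; exact: eq_Ck fg (sf k). Qed.

Lemma smooth_on_differentiable W (f : V -> W) x :
  smooth_on D f -> D x -> differentiable f x.
Proof. by move=> sf; exact: Ck_differentiable (sf 1). Qed.

Lemma smooth_on_derive W (f : V -> W) v :
  smooth_on D f -> smooth_on D (fun x => 'D_v f x).
Proof. by move=> sf k; have [_] := sf k.+1; apply. Qed.

Lemma smooth_on_cst W (a : W) : smooth_on D (cst a).
Proof. by move=> k; exact: Ck_cst. Qed.

Lemma smooth_onD W (f g : V -> W) :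
  smooth_on D f -> smooth_on D g -> smooth_on D (fun x => f x + g x).
Proof. by move=> sf sg k; exact: Ck_add. Qed.

Lemma smooth_on_bilinear U W X (B : {bilinear U -> W -> X})
    (f : V -> U) (g : V -> W) : continuous (fun p : U * W => B p.1 p.2) ->
  smooth_on D f -> smooth_on D g -> smooth_on D (fun x => B (f x) (g x)).
Proof. by move=> Bc sf sg k; exact: Ck_bilinear. Qed.

Lemma smooth_on_linear W X (L : {linear W -> X}) (f : V -> W) :
  continuous L -> smooth_on D f -> smooth_on D (fun x => L (f x)).
Proof. by move=> Lc sf k; exact: Ck_linear. Qed.

Lemma smooth_onZ W (a : V -> R^o) (f : V -> W) :
  smooth_on D a -> smooth_on D f -> smooth_on D (fun x => a x *: f x).
Proof. exact: (smooth_on_bilinear (@scale_bil_continuous R W)). Qed.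

Lemma smooth_onM (a b : V -> R^o) :
  smooth_on D a -> smooth_on D b -> smooth_on D (fun x => a x * b x : R^o).
Proof. exact: smooth_onZ. Qed.

Lemma smooth_onZl W (a : R) (f : V -> W) :
  smooth_on D f -> smooth_on D (fun x => a *: f x).
Proof. by apply: smooth_onZ; exact: smooth_on_cst. Qed.

Lemma smooth_onN W (f : V -> W) : smooth_on D f -> smooth_on D (fun x => - f x).
Proof.
by move=> sf; apply: eq_smooth_on (smooth_onZl (-1) sf) => x _; rewrite scaleN1r.
Qed.

Lemma smooth_on_sum W (I : Type) (r : seq I) (P : pred I) (f : I -> V -> W) :
  (forall i, P i -> smooth_on D (f i)) ->
  smooth_on D (fun x => \sum_(i <- r | P i) f i x).
Proof.
move=> sf; rewrite (_ : (fun x => _) = \sum_(i <- r | P i) f i); last first.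
  by apply/funext => x; rewrite fct_sumE.
elim/big_ind: _ => [|g h sg sh|i]; [exact: smooth_on_cst | exact: smooth_onD | exact: sf].
Qed.

Lemma smooth_on_prod (I : Type) (r : seq I) (P : pred I) (f : I -> V -> R^o) :
  (forall i, P i -> smooth_on D (f i)) ->
  smooth_on D (fun x => \prod_(i <- r | P i) f i x : R^o).
Proof.
move=> sf; elim: r => [|i r IH].
  by apply: eq_smooth_on (smooth_on_cst (1 : R^o)) => x _; rewrite big_nil.
case: (boolP (P i)) => Pi.
  by apply: eq_smooth_on (smooth_onM (sf _ Pi) IH) => x _; rewrite big_cons Pi.
by apply: eq_smooth_on IH => x _; rewrite big_cons (negbTE Pi).
Qed.

(** The derivative of 1/f is -f^-2 'D_v f, which involves 1/f itself only to one order less, where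
    the induction hypothesis applies. *)
Lemma Ck_inv k (f : V -> R^o) : (forall x, D x -> f x != 0) ->
  Ck k D f -> Ck k D (fun x => (f x)^-1 : R^o).
Proof.
move=> f0; elim: k => [|k IH] Cf.
  by move=> x Dx; apply: (@cvgV R V (nbhs x) _ f (f x)); [exact: f0 | exact: Cf].
have [df C1f] := Cf.
split=> [x Dx|v].
  by apply: (@differentiableV _ _ f); [exact: df | exact: f0].
have Civ := IH (CkS Cf).
pose M (a b : V -> R^o) := fun x => scale_bil R^o (a x) (b x).
pose fV x := (f x)^-1.
(* Writing -f^-2 'D_v f as nested products lets [Ck_bilinear] be applied three times. *)
apply: (@eq_Ck _ _ _ oD _ _ (M (cst (-1)) (M fV (M fV ('D_v f))))).
  move=> x Dx; rewrite (@deriveV _ _ f) ?f0//; last exact/diff_derivable/df.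
  by rewrite /M /fV /= /cst scaleN1r scalerA scaleNr -exprVn expr2.
have Mc := @scale_bil_continuous R R^o.
apply: Ck_bilinear => //; first exact: Ck_cst.
by apply: Ck_bilinear => //; apply: Ck_bilinear => //; exact: C1f.
Qed.

Lemma smooth_onV (f : V -> R^o) : (forall x, D x -> f x != 0) ->
  smooth_on D f -> smooth_on D (fun x => (f x)^-1 : R^o).
Proof. by move=> f0 sf k; exact: Ck_inv. Qed.

(** The determinant is a sum over permutations of signed products of entries. *)
Lemma smooth_on_det n (A : V -> 'M[R]_n) :
  (forall i j, smooth_on D (fun x => A x i j : R^o)) ->
  smooth_on D (fun x => \det (A x) : R^o).
Proof.
move=> sA; apply: smooth_on_sum => s _; apply: smooth_onM; first exact: smooth_on_cst.
by apply: smooth_on_prod => i _; exact: sA.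
Qed.

Lemma smooth_on_invmx n (A : V -> 'M[R]_n) i j :
  (forall x, D x -> A x \in unitmx) ->
  (forall i j, smooth_on D (fun x => A x i j : R^o)) ->
  smooth_on D (fun x => invmx (A x) i j : R^o).
Proof.
move=> uA sA.
(* Cramer's rule: the (i, j) entry of the inverse is the (j, i) cofactor divided by the
   determinant. *)
apply: (@eq_smooth_on _ (fun x => (\det (A x))^-1 * ((-1) ^+ (j + i) *
    \det (row' j (col' i (A x)))) : R^o)) => [x Dx|].
  by rewrite /invmx uA// !mxE.
apply: smooth_onM.
  apply: smooth_onV (smooth_on_det sA) => x Dx.
  by rewrite -unitfE -unitmxE uA.
apply: smooth_onM; first exact: smooth_on_cst.
apply: smooth_on_det => k l.
by apply: eq_smooth_on (sA (lift j k) (lift i l)) => x _; rewrite !mxE.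
Qed.

Lemma smooth_on_coord m n (A : V -> 'M[R]_(m, n)) i j :
  smooth_on D A -> smooth_on D (fun x => A x i j : R^o).
Proof.
have lin : linear (fun B : 'M[R]_(m, n) => B i j : R^o).
  by move=> a u v; rewrite !mxE.
pose L : {linear 'M[R]_(m, n) -> R^o} :=
  HB.pack (fun B : 'M[R]_(m, n) => B i j : R^o) (GRing.isLinear.Build _ _ _ _ _ lin).
by apply: (@smooth_on_linear _ _ L); exact: coord_continuous.
Qed.

End SmoothOn.

(* The contraction over the first two indices of the metric compatibility
   d_i g^jk + Gamma^j_il g^lk + Gamma^k_il g^jl = 0, with G the inverse metric,
   d l i j = d_l g_ij, and d_i g^jk = - g^ja (d_i g_ab) g^bk. *)
Lemma contracted_christoffel (R : numFieldType) m (G : 'I_m -> 'I_m -> R)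
    (d : 'I_m -> 'I_m -> 'I_m -> R) (k : 'I_m) :
  (forall i j, G i j = G j i) -> (forall l i j, d l i j = d l j i) ->
  let Gam k i j := 2^-1 * \sum_l G k l * (d i j l + d j i l - d l i j) in
  - (\sum_i \sum_a \sum_b G i a * d i a b * G b k)
  + \sum_i \sum_l Gam i i l * G l k + \sum_i \sum_j G i j * Gam k i j = 0.
Proof.
move=> Gs ds Gam.
set S1 := \sum_i _; pose S2 := \sum_i \sum_a \sum_l G i a * d l i a * G l k.
(* This is the formula Gamma^i_il = 1/2 g^ia d_l g_ia, half the logarithmic derivative of det g. The
   other two terms of the Christoffel symbol cancel after exchanging [i] and [a]. *)
have -> : \sum_i \sum_l Gam i i l * G l k = 2^-1 * S2.
  transitivity (2^-1 * (S2 + \sum_l (\sum_i \sum_a G i a * d i l a * G l k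
                         - \sum_i \sum_a G i a * d a i l * G l k))).
    rewrite exchange_big /S2 /=.
    under [X in _ = _ * (X + _)]eq_bigr do rewrite exchange_big /=.
    rewrite [X in _ = _ * (X + _)]exchange_big -big_split mulr_sumr /=.
    apply: eq_bigr => l _; rewrite -sumrB -big_split mulr_sumr /=.
    apply: eq_bigr => i _; rewrite /Gam -mulrA mulr_suml; congr (_ * _).
    by rewrite -sumrB -big_split /=; apply: eq_bigr => a _; ring.
  rewrite big1 ?addr0// => l _; apply/eqP; rewrite subr_eq0; apply/eqP.
  rewrite exchange_big; apply: eq_bigr => i _; apply: eq_bigr => a _.
  by rewrite Gs ds (Gs i).
(* The first two terms of the Christoffel symbol have the same trace [S1], by exchanging [i] and
   [j]; the third contributes [S2]. *)
have -> : \sum_i \sum_j G i j * Gam k i j = S1 - 2^-1 * S2.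
  have e3 : \sum_i \sum_j \sum_l G i j * d j i l * G l k = S1.
    rewrite exchange_big; apply: eq_bigr => i _; apply: eq_bigr => j _.
    by apply: eq_bigr => l _; rewrite (Gs j).
  transitivity (2^-1 * (S1 + \sum_i \sum_j \sum_l G i j * d j i l * G l k - S2)).
    rewrite /S1 /S2 -big_split -sumrB mulr_sumr; apply: eq_bigr => i _ /=.
    rewrite -big_split -sumrB mulr_sumr; apply: eq_bigr => j _ /=.
    rewrite -big_split -sumrB /Gam mulrCA; congr (_ * _); rewrite mulr_sumr.
    by apply: eq_bigr => l _ /=; rewrite (Gs l k); ring.
  by rewrite e3; field.
by ring.
Qed.

(** * Partial derivatives and smoothness in a fixed chart *)

Section ChartCalculus.
Variables (R : realType) (m : nat) (M : riemannian_manifold R m) (c : atlas M).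
Implicit Types (U W X : normedModType R).

(** The part of [smooth_map] that concerns one chart. Functions such as [laplacian c f] are
    coordinate expressions, meaningful on [dom c] only, so their smoothness is stated in [c]
    alone. *)
Definition smooth_in W (f : M -> W) : Prop :=
  smooth_on (chart c @` dom c) (f \o chart_inv c).

Let oD : open (chart c @` dom c) := @chart_open _ _ M c.
Hint Resolve oD : core.

Lemma eq_smooth_in W (f g : M -> W) :
  (forall q, dom c q -> f q = g q) -> smooth_in f -> smooth_in g.
Proof.
move=> fg; apply: eq_smooth_on => // _ [q dq <-].
by rewrite /= !chartK ?fg.
Qed.

Lemma smooth_in_differentiable W (f : M -> W) p :
  smooth_in f -> dom c p -> differentiable (f \o chart_inv c) (chart c p).
Proof. by move=> sf dp; apply: smooth_on_differentiable sf _; exists p. Qed.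

(** The image of [dom c] is open, so agreement on [dom c] is agreement near [chart c p], which
    determines the derivative. *)
Lemma eq_pd W (f g : M -> W) i p : (forall q, dom c q -> f q = g q) ->
  dom c p -> pd c i f p = pd c i g p.
Proof.
move=> fg dp; apply: near_eq_derive.
have := open_nbhs_nbhs (conj oD (ex_intro2 _ _ p dp erefl)).
by apply: filterS => _ [q dq <-] /=; rewrite !chartK ?fg.
Qed.

Lemma smooth_in_pd W (f : M -> W) i : smooth_in f -> smooth_in (pd c i f).
Proof.
move=> sf.
apply: eq_smooth_on (smooth_on_derive (delta_mx ord0 i) sf) => // _ [q dq <-].
by rewrite /= /pd /= chartK.
Qed.

Lemma smooth_in_sum W (I : Type) (r : seq I) (P : pred I) (f : I -> M -> W) :
  (forall i, P i -> smooth_in (f i)) ->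
  smooth_in (fun x => \sum_(i <- r | P i) f i x).
Proof. exact: smooth_on_sum. Qed.

Lemma smooth_in_bilinear U W X (B : {bilinear U -> W -> X})
    (f : M -> U) (g : M -> W) : continuous (fun p : U * W => B p.1 p.2) ->
  smooth_in f -> smooth_in g -> smooth_in (fun q => B (f q) (g q)).
Proof. exact: smooth_on_bilinear. Qed.

Lemma smooth_inZ W (a : M -> R^o) (f : M -> W) :
  smooth_in a -> smooth_in f -> smooth_in (fun x => a x *: f x).
Proof. exact: smooth_onZ. Qed.

Lemma smooth_inD W (f g : M -> W) :
  smooth_in f -> smooth_in g -> smooth_in (fun x => f x + g x).
Proof. exact: smooth_onD. Qed.

Lemma smooth_inZl W a (f : M -> W) : smooth_in f -> smooth_in (fun x => a *: f x).
Proof. exact: smooth_onZl. Qed.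

Lemma smooth_inN W (f : M -> W) : smooth_in f -> smooth_in (fun x => - f x).
Proof. exact: smooth_onN. Qed.

Lemma pdD W (f g : M -> W) i p : smooth_in f -> smooth_in g -> dom c p ->
  pd c i (fun q => f q + g q) p = pd c i f p + pd c i g p.
Proof.
move=> sf sg dp.
by apply: (@deriveD _ _ _ (f \o chart_inv c) (g \o chart_inv c));
  apply: diff_derivable; apply: smooth_in_differentiable.
Qed.

Lemma pd_bilinear U W X (B : {bilinear U -> W -> X}) (f : M -> U) (g : M -> W) i p :
  continuous (fun p : U * W => B p.1 p.2) ->
  smooth_in f -> smooth_in g -> dom c p ->
  pd c i (fun q => B (f q) (g q)) p = B (pd c i f p) (g p) + B (f p) (pd c i g p).
Proof.
move=> Bc sf sg dp.
rewrite [LHS](@derive_bilinear _ _ _ _ _ B Bc (f \o chart_inv c) (g \o chart_inv c));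
  [|exact: smooth_in_differentiable|exact: smooth_in_differentiable].
by rewrite /= chartK.
Qed.

Lemma pd_cst W (a : W) i p : pd c i (fun=> a) p = 0.
Proof. exact: derive_cst. Qed.

Lemma pdZ W (a : M -> R^o) (f : M -> W) i p :
  smooth_in a -> smooth_in f -> dom c p ->
  pd c i (fun q => a q *: f q) p = pd c i a p *: f p + a p *: pd c i f p.
Proof. exact: (pd_bilinear i (@scale_bil_continuous R W)). Qed.

Lemma pdZl W a (f : M -> W) i p : smooth_in f -> dom c p ->
  pd c i (fun q => a *: f q) p = a *: pd c i f p.
Proof.
move=> sf dp; rewrite (@pdZ _ (fun=> a)) ?pd_cst ?scale0r ?add0r//.
exact: smooth_on_cst.
Qed.

Lemma pd_sum W (I : Type) (r : seq I) (P : pred I) (f : I -> M -> W) i p :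
  (forall k, P k -> smooth_in (f k)) -> dom c p ->
  pd c i (fun q => \sum_(k <- r | P k) f k q) p = \sum_(k <- r | P k) pd c i (f k) p.
Proof.
move=> sf dp; elim: r => [|k r IH].
  rewrite big_nil -[RHS](pd_cst (0 : W) i p).
  by apply: eq_pd => // q _; rewrite big_nil.
rewrite big_cons -IH; case: (boolP (P k)) => Pk.
  rewrite -pdD//; [|exact: sf|exact: smooth_in_sum].
  by apply: eq_pd => // q _; rewrite big_cons Pk.
by apply: eq_pd => // q _; rewrite big_cons (negbTE Pk).
Qed.

(** A nonzero vector in the kernel would have length zero, against positive definiteness. *)
Lemma metric_unit p : dom c p -> metric c p \in unitmx.
Proof.
move=> dp; rewrite -row_free_unit -kermx_eq0; apply/rowV0P => v /sub_kermxP vg.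
apply/eqP; apply: contraT => /(metric_pos dp).
by rewrite vg mul0mx mxE ltxx.
Qed.

Lemma invmetricC p i j : dom c p -> invmetric c p i j = invmetric c p j i.
Proof.
move=> dp; rewrite /invmetric -[in LHS](Defs.metric_sym dp) -trmx_inv mxE.
by [].
Qed.

Lemma metric_coefC p i j : dom c p -> metric c p i j = metric c p j i.
Proof. by move=> dp; rewrite -[in LHS](Defs.metric_sym dp) mxE. Qed.

Lemma smooth_in_metric i j : smooth_in (fun q => metric c q i j : R^o).
Proof. by apply: (smooth_on_coord oD); exact: metric_smooth. Qed.

Lemma smooth_in_invmetric i j : smooth_in (fun q => invmetric c q i j : R^o).
Proof.
apply: smooth_on_invmx => // [_ [q dq <-]|k l] /=.
  by rewrite chartK// metric_unit.
exact: smooth_in_metric.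
Qed.

Lemma smooth_in_grad W (f : M -> W) i : smooth_in f -> smooth_in (grad c f i).
Proof.
move=> sf; apply: smooth_in_sum => j _; apply: smooth_inZ.
  exact: smooth_in_invmetric.
exact: smooth_in_pd.
Qed.

Lemma smooth_in_christoffel k i j : smooth_in (christoffel c k i j : M -> R^o).
Proof.
apply: (@smooth_inZl _ 2^-1); apply: smooth_in_sum => l _.
apply: (@smooth_inZ R^o); first exact: smooth_in_invmetric.
apply: smooth_inD; last first.
  by apply: smooth_inN; apply: smooth_in_pd; exact: smooth_in_metric.
by apply: smooth_inD; apply: smooth_in_pd; exact: smooth_in_metric.
Qed.

Lemma smooth_in_laplacian W (f : M -> W) : smooth_in f -> smooth_in (laplacian c f).
Proof.
move=> sf; apply: smooth_in_sum => i _; apply: smooth_inD.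
  by apply: smooth_in_pd; exact: smooth_in_grad.
apply: smooth_in_sum => k _; apply: smooth_inZ; last exact: smooth_in_grad.
exact: smooth_in_christoffel.
Qed.

Lemma smooth_in_sqnorm_d N (f : M -> 'rV[R]_N) :
  smooth_in f -> smooth_in (sqnorm_d c f : M -> R^o).
Proof.
move=> sf; apply: smooth_in_sum => i _; apply: smooth_in_sum => j _.
apply: smooth_inZ; first exact: smooth_in_invmetric.
by apply: (smooth_in_bilinear (@dotv_bil_continuous R N)); exact: smooth_in_pd.
Qed.

(** With G the inverse of g, differentiating G g = 1 gives dG g + G dg = 0, which is solved for dG
    by multiplying by G on the right. *)
Lemma pd_invmetric l i j p : dom c p ->
  pd c l (fun q => invmetric c q i j : R^o) p =
  - \sum_a \sum_b invmetric c p i a * pd c l (fun q => metric c q a b : R^o) p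
                  * invmetric c p b j.
Proof.
move=> dp.
pose dG := \matrix_(i, j) pd c l (fun q => invmetric c q i j : R^o) p.
pose dg := \matrix_(i, j) pd c l (fun q => metric c q i j : R^o) p.
have gu := metric_unit dp.
have dGg : dG *m metric c p + invmetric c p *m dg = 0.
  apply/matrixP => a b; rewrite !mxE -big_split /=.
  (* Zero is read as the derivative of an entry of the identity matrix, to be compared with that of
     the same entry of G g. *)
  rewrite -[RHS](pd_cst ((a == b)%:R : R^o) l p).
  transitivity (pd c l (fun q => \sum_k (invmetric c q a k : R^o) *: (metric c q k b : R^o)) p).
    rewrite pd_sum //; last first.
      by move=> k _; apply: smooth_inZ; [exact: smooth_in_invmetric | exact: smooth_in_metric].
    apply: eq_bigr => k _.
    by rewrite pdZ ?mxE//; [exact: smooth_in_invmetric | exact: smooth_in_metric].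
  apply: eq_pd => // q dq.
  have /matrixP/(_ a b) := mulVmx (metric_unit dq).
  by rewrite !mxE => <-.
have -> : pd c l (fun q => invmetric c q i j : R^o) p = dG i j by rewrite mxE.
have -> : dG = - (invmetric c p *m dg *m invmetric c p).
  by move/eqP: dGg; rewrite addr_eq0 => /eqP dGg; rewrite -mulNmx -dGg mulmxK.
rewrite !mxE exchange_big /=; congr (- _); apply: eq_bigr => b _.
by rewrite !mxE mulr_suml; apply: eq_bigr => a _; rewrite !mxE.
Qed.

End ChartCalculus.

(** The algebra behind div grad f = tr (nabla df), with [u j] for d_j f and [h i j] for d_i d_j f.
    The terms in [h] agree on both sides, and in the difference the coefficient of [u k] is the sum
    assumed to vanish. *)
Lemma contract_laplacian (R : pzRingType) (W : lmodType R) m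
    (G : 'I_m -> 'I_m -> R) (dG Gam : 'I_m -> 'I_m -> 'I_m -> R)
    (u : 'I_m -> W) (h : 'I_m -> 'I_m -> W) :
  (forall k, \sum_i dG i i k + \sum_i \sum_l Gam i i l * G l k
             + \sum_i \sum_j G i j * Gam k i j = 0) ->
  \sum_i (\sum_j (dG i i j *: u j + G i j *: h i j)
          + \sum_k Gam i i k *: \sum_l G k l *: u l) =
  \sum_i \sum_j G i j *: (h i j - \sum_k Gam k i j *: u k).
Proof.
move=> H; apply/eqP; rewrite -subr_eq0; apply/eqP.
have r1 : \sum_i \sum_j G i j *: (h i j - \sum_k Gam k i j *: u k) =
    \sum_i \sum_j G i j *: h i j - \sum_k (\sum_i \sum_j G i j * Gam k i j) *: u k.
  under [X in _ = _ - X]eq_bigr do rewrite scaler_suml.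
  rewrite [X in _ = _ - X]exchange_big -sumrB /=; apply: eq_bigr => i _.
  under [X in _ = _ - X]eq_bigr do rewrite scaler_suml.
  rewrite [X in _ = _ - X]exchange_big -sumrB /=; apply: eq_bigr => j _.
  rewrite scalerBr scaler_sumr; congr (_ - _).
  by apply: eq_bigr => k _; rewrite scalerA.
have r2 : \sum_i \sum_k Gam i i k *: (\sum_l G k l *: u l) =
    \sum_l (\sum_i \sum_k Gam i i k * G k l) *: u l.
  under [RHS]eq_bigr do rewrite scaler_suml.
  rewrite [RHS]exchange_big; apply: eq_bigr => i _ /=.
  under [RHS]eq_bigr do rewrite scaler_suml.
  rewrite [RHS]exchange_big; apply: eq_bigr => k _ /=.
  by rewrite scaler_sumr; apply: eq_bigr => l _; rewrite scalerA.
have r3 : \sum_i \sum_j (dG i i j *: u j + G i j *: h i j) =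
    \sum_k (\sum_i dG i i k) *: u k + \sum_i \sum_j G i j *: h i j.
  under [X in _ = X + _]eq_bigr do rewrite scaler_suml.
  rewrite [X in _ = X + _]exchange_big -big_split /=; apply: eq_bigr => i _.
  by rewrite -big_split.
have cancel a b d e : a + b + d - (b - e) = a + d + e :> W.
  by rewrite opprB (addrAC a) addrACA subrr addr0.
rewrite big_split /= r1 r2 r3 cancel -!big_split big1 // => k _ /=.
by rewrite -!scalerDl H scale0r.
Qed.

(** * Laplacian and divergence of one-forms; Leibniz rules *)

Section Divergence.
Variables (R : realType) (m : nat) (M : riemannian_manifold R m) (c : atlas M).
Implicit Types (U W X : normedModType R).

(** The product rule on [grad c f] produces derivatives of the inverse metric. [pd_invmetric]
    expresses them by those of the metric, and [contracted_christoffel] then gives the vanishing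
    that [contract_laplacian] asks for. *)
Lemma laplacian_div1 W (f : M -> W) p : smooth_in c f -> dom c p ->
  laplacian c f p = div1 c (fun j => pd c j f) p.
Proof.
move=> sf dp.
pose G i j := invmetric c p i j.
pose d l i j := pd c l (fun q => metric c q i j : R^o) p.
have Gs i j : G i j = G j i by exact: invmetricC.
have ds l i j : d l i j = d l j i by apply: eq_pd => // q dq; exact: metric_coefC.
have sG i j := @smooth_in_invmetric _ _ _ c i j.
have spd j := @smooth_in_pd _ _ _ c _ _ j sf.
have gradE i : pd c i (grad c f i) p =
    \sum_j (pd c i (fun q => invmetric c q i j : R^o) p *: pd c j f p
            + G i j *: pd c i (pd c j f) p).
  rewrite pd_sum //; last by move=> j _; exact: smooth_inZ.
  by apply: eq_bigr => j _; rewrite pdZ.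
transitivity (\sum_i (\sum_j (pd c i (fun q => invmetric c q i j : R^o) p *: pd c j f p
            + G i j *: pd c i (pd c j f) p) +
     \sum_k christoffel c i i k p *: \sum_l G k l *: pd c l f p)).
  by apply: eq_bigr => i _; rewrite -gradE.
apply: (@contract_laplacian _ _ _ G
  (fun l i j => pd c l (fun q => invmetric c q i j : R^o) p)
  (fun k i j => christoffel c k i j p) (fun j => pd c j f p)
  (fun i j => pd c i (pd c j f) p)) => k.
rewrite -[RHS](contracted_christoffel k Gs ds); congr (_ + _ + _).
by rewrite -sumrN; apply: eq_bigr => i _; rewrite pd_invmetric.
Qed.

Lemma eq_div1 W (w w' : 'I_m -> M -> W) p :
  (forall j q, dom c q -> w j q = w' j q) -> dom c p -> div1 c w p = div1 c w' p.
Proof.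
move=> ww dp; apply: eq_bigr => i _; apply: eq_bigr => j _; congr (_ *: (_ - _)).
  by apply: eq_pd => // q; exact: ww.
by apply: eq_bigr => k _; rewrite ww.
Qed.

Lemma div1D W (w w' : 'I_m -> M -> W) p :
  (forall j, smooth_in c (w j)) -> (forall j, smooth_in c (w' j)) -> dom c p ->
  div1 c (fun j q => w j q + w' j q) p = div1 c w p + div1 c w' p.
Proof.
move=> sw sw' dp; rewrite -big_split; apply: eq_bigr => i _ /=.
rewrite -big_split; apply: eq_bigr => j _ /=.
rewrite -scalerDr; congr (_ *: _); rewrite /nabla1 pdD// addrACA -opprD.
by rewrite -big_split; congr (_ - _); apply: eq_bigr => k _; rewrite scalerDr.
Qed.

Lemma div1Z W a (w : 'I_m -> M -> W) p :
  (forall j, smooth_in c (w j)) -> dom c p ->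
  div1 c (fun j q => a *: w j q) p = a *: div1 c w p.
Proof.
move=> sw dp; rewrite scaler_sumr; apply: eq_bigr => i _.
rewrite scaler_sumr; apply: eq_bigr => j _.
rewrite scalerA mulrC -scalerA; congr (_ *: _).
rewrite /nabla1 pdZl// scalerBr scaler_sumr.
by congr (_ - _); apply: eq_bigr => k _; rewrite !scalerA mulrC.
Qed.

(** The Christoffel terms do not differentiate [f], so they stay with [w] and complete its
    divergence; the trace collects the terms where [f] is differentiated. *)
Lemma div1_bilinear U W X (B : {bilinear U -> W -> X}) (w : 'I_m -> M -> U)
    (f : M -> W) p : continuous (fun p : U * W => B p.1 p.2) ->
  (forall j, smooth_in c (w j)) -> smooth_in c f -> dom c p ->
  div1 c (fun j q => B (w j q) (f q)) p =
  B (div1 c w p) (f p) + metric_trace c (fun i j => B (w j p) (pd c i f p)) p.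
Proof.
move=> Bc sw sf dp; rewrite linear_sumlz -big_split; apply: eq_bigr => i _ /=.
rewrite linear_sumlz -big_split; apply: eq_bigr => j _ /=.
rewrite linearZl_LR -scalerDr; congr (_ *: _).
rewrite /nabla1 pd_bilinear// linearBl linear_sumlz addrAC.
by congr (_ - _ + _); apply: eq_bigr => k _; rewrite linearZl_LR.
Qed.

Lemma metric_trace_swap W (b : 'I_m -> 'I_m -> W) p : dom c p ->
  metric_trace c b p = metric_trace c (fun i j => b j i) p.
Proof.
move=> dp; rewrite /metric_trace exchange_big.
by apply: eq_bigr => i _; apply: eq_bigr => j _; rewrite invmetricC.
Qed.

(** Symmetry of the inverse metric makes the trace equal to its own negative. *)
Lemma metric_trace_skew W (b : 'I_m -> 'I_m -> W) p : dom c p ->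
  (forall i j, b i j = - b j i) -> metric_trace c b p = 0.
Proof.
move=> dp bs; have TN : metric_trace c b p = - metric_trace c b p.
  rewrite {1}metric_trace_swap// -sumrN; apply: eq_bigr => i _ /=.
  by rewrite -sumrN; apply: eq_bigr => j _; rewrite bs scalerN.
apply/eqP; have /eqP : 2 *: metric_trace c b p = 0.
  by rewrite scaler_nat mulr2n {2}TN subrr.
by rewrite scaler_eq0 pnatr_eq0.
Qed.

Lemma div1N W (w : 'I_m -> M -> W) p :
  (forall j, smooth_in c (w j)) -> dom c p ->
  div1 c (fun j q => - w j q) p = - div1 c w p.
Proof.
move=> sw dp; rewrite -scaleN1r -div1Z//; apply: eq_div1 => // j q _.
by rewrite scaleN1r.
Qed.

Lemma div1B W (w w' : 'I_m -> M -> W) p :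
  (forall j, smooth_in c (w j)) -> (forall j, smooth_in c (w' j)) -> dom c p ->
  div1 c (fun j q => w j q - w' j q) p = div1 c w p - div1 c w' p.
Proof.
move=> sw sw' dp; rewrite -div1N// -div1D// => j; exact: smooth_inN.
Qed.

(** * From one pointwise relation between divergences to both forms of the law *)

Section DivergenceRelation.
Variables (W : normedModType R) (u v w x : 'I_m -> M -> W) (a b : R) (p : M).
Hypotheses (su : forall j, smooth_in c (u j)) (sv : forall j, smooth_in c (v j)).
Hypotheses (sw : forall j, smooth_in c (w j)) (sx : forall j, smooth_in c (x j)).
Hypothesis dp : dom c p.
Hypothesis rel :
  b *: (div1 c u p - div1 c v p + div1 c w p) = a *: div1 c x p.

(** To be applied with [u] = dL /\ phi, [v] = L /\ dphi, [w] = 2e dphi /\ phi, [x] = dphi /\ phi,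
    where L is the Laplacian of phi, and with [a] = delta1, [b] = delta2. *)
Lemma div1_relation :
  div1 c (fun j q => b *: (u j q - v j q + w j q) - a *: x j q) p = 0.
Proof.
have suv j : smooth_in c (fun q => u j q - v j q).
  by apply: smooth_inD; [exact: su | exact: smooth_inN].
have suvw j : smooth_in c (fun q => u j q - v j q + w j q).
  exact: smooth_inD.
rewrite div1B//; [|by move=> j; exact: smooth_inZl..].
by rewrite (div1Z b suvw dp) (div1Z a sx dp) (div1D suv sw dp) (div1B su sv dp) rel subrr.
Qed.

(** Solving [rel] for div u gives div v - div w + (a / b) div x. The combination [u + v] matters
    because it will be d(L /\ phi), whose divergence is a Laplacian. *)
Lemma div1_relation_solved : b != 0 ->
  div1 c (fun j q => u j q + v j q) p =
  div1 c (fun j q => 2 *: v j q - w j q + (a / b) *: x j q) p.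
Proof.
move=> b0.
have s2v j : smooth_in c (fun q => 2 *: v j q) by exact: smooth_inZl.
have s2vw j : smooth_in c (fun q => 2 *: v j q - w j q).
  by apply: smooth_inD; [exact: s2v | exact: smooth_inN].
rewrite (div1D su sv dp) div1D//; last by move=> j; exact: smooth_inZl.
rewrite (div1B s2v sw dp) (div1Z 2 sv dp) (div1Z (a / b) sx dp).
rewrite mulrC -scalerA -rel scalerA mulVf// scale1r scaler_nat mulr2n.
by rewrite [RHS]addrC [RHS]addrACA subrr addr0 addrA subrK.
Qed.

End DivergenceRelation.

(** * Divergence of exterior products *)

Section Wedge.
Variable N : nat.

Lemma smooth_in_wedge (u v : M -> 'rV[R]_N) :
  smooth_in c u -> smooth_in c v -> smooth_in c (fun q => wedge (u q) (v q)).
Proof. exact: (smooth_in_bilinear (@wedge_bil_continuous R N)). Qed.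

Lemma div1_wedge (w : 'I_m -> M -> 'rV[R]_N) (f : M -> 'rV[R]_N) p :
  (forall j, smooth_in c (w j)) -> smooth_in c f -> dom c p ->
  div1 c (fun j q => wedge (w j q) (f q)) p =
  wedge (div1 c w p) (f p) + metric_trace c (fun i j => wedge (w j p) (pd c i f p)) p.
Proof. exact: (div1_bilinear (@wedge_bil_continuous R N)). Qed.

Lemma div1_dwedge (f g : M -> 'rV[R]_N) p :
  smooth_in c f -> smooth_in c g -> dom c p ->
  div1 c (fun j q => wedge (pd c j f q) (g q)) p =
  wedge (laplacian c f p) (g p)
  + metric_trace c (fun i j => wedge (pd c j f p) (pd c i g p)) p.
Proof.
move=> sf sg dp; rewrite laplacian_div1// -div1_wedge// => j.
exact: smooth_in_pd.
Qed.

Lemma wedgeZl a (u v : 'rV[R]_N) : wedge (a *: u) v = a *: wedge u v.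
Proof. exact: (linearZl_LR (wedge_bil R N)). Qed.

Lemma wedgeDl (u v w : 'rV[R]_N) : wedge (u + v) w = wedge u w + wedge v w.
Proof. exact: (linearDl (wedge_bil R N)). Qed.

Lemma div1_wedged (f g : M -> 'rV[R]_N) p :
  smooth_in c f -> smooth_in c g -> dom c p ->
  div1 c (fun j q => wedge (f q) (pd c j g q)) p =
  wedge (f p) (laplacian c g p)
  + metric_trace c (fun i j => wedge (pd c i f p) (pd c j g p)) p.
Proof.
move=> sf sg dp.
have -> : (fun j q => wedge (f q) (pd c j g q)) = fun j q => - wedge (pd c j g q) (f q).
  by apply/funext => j; apply/funext => q; exact: wedgeC.
rewrite div1N; last 2 first.
- by move=> j; apply: smooth_in_wedge => //; exact: smooth_in_pd.
- exact: dp.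
rewrite (div1_dwedge sg sf dp) opprD -wedgeC; congr (_ + _).
rewrite -sumrN; apply: eq_bigr => i _; rewrite -sumrN; apply: eq_bigr => j _.
by rewrite -scalerN -wedgeC.
Qed.

(** A pointwise Green identity for the exterior product: the two gradient traces are transposes of
    each other, hence equal, and cancel. *)
Lemma div1_dwedgeB (f g : M -> 'rV[R]_N) p :
  smooth_in c f -> smooth_in c g -> dom c p ->
  div1 c (fun j q => wedge (pd c j f q) (g q)) p
  - div1 c (fun j q => wedge (f q) (pd c j g q)) p =
  wedge (laplacian c f p) (g p) - wedge (f p) (laplacian c g p).
Proof.
move=> sf sg dp.
have cancel (x y t : 'M[R]_N) : x + t - (y + t) = x - y.
  by rewrite opprD addrACA subrr addr0.
have swap := metric_trace_swap (fun i j => wedge (pd c i f p) (pd c j g p)) dp.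
have dfg := div1_dwedge sf sg dp.
have fdg := etrans (div1_wedged sf sg dp) (congr1 (+%R _) swap).
exact: etrans (congr2 (fun x y => x - y) dfg fdg) (cancel _ _ _).
Qed.

(** Wedging with [v] kills the multiples of [v] on both sides. *)
Lemma wedge_eq_tangent a b s t (x y z v : 'rV[R]_N) :
  a *: (x + s *: v + 2 *: y) = b *: (z + t *: v) ->
  a *: (wedge x v + 2 *: wedge y v) = b *: wedge z v.
Proof.
move=> /(congr1 (fun w => wedge w v)).
by rewrite !(wedgeZl, wedgeDl) wedgevv !scaler0 !addr0.
Qed.

End Wedge.

(** * The conservation law from the equation modulo multiples of phi *)

Section SphereValued.
Variables (N : nat) (phi : M -> 'rV[R]_N) (e : M -> R^o).
Hypotheses (sphi : smooth_in c phi) (se : smooth_in c e).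

Let L := laplacian c phi.

Let sL : smooth_in c L. Proof. exact: smooth_in_laplacian. Qed.
Let sdphi j : smooth_in c (pd c j phi). Proof. exact: smooth_in_pd. Qed.
Let sdL j : smooth_in c (pd c j L). Proof. exact: smooth_in_pd. Qed.

(** The remaining trace is that of dphi /\ dphi, which is skew in its two indices. *)
Lemma div1_dwedge_self p : dom c p ->
  div1 c (fun j q => wedge (pd c j phi q) (phi q)) p = wedge (L p) (phi p).
Proof.
move=> dp; rewrite (div1_dwedge sphi sphi dp) metric_trace_skew ?addr0// => i j.
exact: wedgeC.
Qed.

Lemma div1_weighted_dwedge_self p : dom c p ->
  div1 c (fun j q => (2 * e q) *: wedge (pd c j phi q) (phi q)) p =
  2 *: wedge (div1 c (fun j q => e q *: pd c j phi q) p) (phi p).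
Proof.
move=> dp; have sephi j : smooth_in c (fun q => e q *: pd c j phi q).
  exact: smooth_inZ.
(* The weight [e] is absorbed into the one-form, so that the Leibniz rule yields div (e dphi), the
   term present in the equation. *)
have -> : (fun j q => (2 * e q) *: wedge (pd c j phi q) (phi q)) =
    fun j q => 2 *: wedge (e q *: pd c j phi q) (phi q).
  by apply/funext => j; apply/funext => q; rewrite wedgeZl scalerA.
rewrite div1Z; last 2 first.
- by move=> j; exact: smooth_in_wedge.
- exact: dp.
rewrite (div1_wedge sephi sphi dp); congr (_ *: _).
have skew a (x y : 'rV[R]_N) : wedge (a *: x) y = - wedge (a *: y) x.
  by rewrite !wedgeZl -scalerN -wedgeC.
rewrite metric_trace_skew ?addr0// => i j; exact: skew.
Qed.

Variables delta1 delta2 : R.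

(** The coefficients of [phi] are left existential because those terms disappear on wedging with
    [phi]. *)
Hypothesis phi_eq : forall p, dom c p -> exists s t : R,
  delta2 *: (laplacian c L p + s *: phi p
             + 2 *: div1 c (fun j q => e q *: pd c j phi q) p)
  = delta1 *: (L p + t *: phi p).

(** The equation wedged with [phi], each term rewritten as a divergence; it is the hypothesis [rel]
    of the two relation lemmas. *)
Let div_current p : dom c p ->
  delta2 *: (div1 c (fun j q => wedge (pd c j L q) (phi q)) p
             - div1 c (fun j q => wedge (L q) (pd c j phi q)) p
             + div1 c (fun j q => (2 * e q) *: wedge (pd c j phi q) (phi q)) p)
  = delta1 *: div1 c (fun j q => wedge (pd c j phi q) (phi q)) p.
Proof.
move=> dp; have [s [t /wedge_eq_tangent eq_phi]] := phi_eq dp.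
(* In [div1_dwedgeB] for [L] and [phi], the second term is L /\ L, as the Laplacian of [phi] is [L]
   itself. *)
have cancel (x y z : 'rV[R]_N) : wedge x y - wedge z z = wedge x y.
  by rewrite wedgevv subr0.
have dAB := etrans (div1_dwedgeB sL sphi dp) (cancel _ _ _).
have dC := div1_weighted_dwedge_self dp.
apply: etrans (congr1 ( *:%R delta1) (esym (div1_dwedge_self dp))).
exact: etrans (congr1 ( *:%R delta2) (congr2 +%R dAB dC)) eq_phi.
Qed.

Let sA j : smooth_in c (fun q => wedge (pd c j L q) (phi q)).
Proof. exact: smooth_in_wedge. Qed.
Let sB j : smooth_in c (fun q => wedge (L q) (pd c j phi q)).
Proof. exact: smooth_in_wedge. Qed.
Let sE j : smooth_in c (fun q => wedge (pd c j phi q) (phi q)).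
Proof. exact: smooth_in_wedge. Qed.
Let sC j : smooth_in c (fun q => (2 * e q) *: wedge (pd c j phi q) (phi q)).
Proof. by apply: smooth_inZ; [exact: (smooth_inZl 2 se) | exact: sE]. Qed.

Lemma conservation_law p : dom c p ->
  div1 c (fun j q =>
    delta2 *: (wedge (pd c j L q) (phi q) - wedge (L q) (pd c j phi q)
               + (2 * e q) *: wedge (pd c j phi q) (phi q))
    - delta1 *: wedge (pd c j phi q) (phi q)) p = 0.
Proof. by move=> dp; exact: (div1_relation sA sB sC sE dp (div_current dp)). Qed.

Lemma conservation_law_laplacian p : delta2 != 0 -> dom c p ->
  laplacian c (div1 c (fun j q => wedge (pd c j phi q) (phi q))) p
  = div1 c (fun j q =>
      2 *: wedge (L q) (pd c j phi q)
      - (2 * e q) *: wedge (pd c j phi q) (phi q)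
      + (delta1 / delta2) *: wedge (pd c j phi q) (phi q)) p.
Proof.
move=> d20 dp.
rewrite -(div1_relation_solved sA sB sC sE dp (div_current dp) d20).
(* On [dom c] this divergence is L /\ phi, which gives its smoothness here and, below, its
   differential dL /\ phi + L /\ dphi. *)
have sdE : smooth_in c (div1 c (fun j q => wedge (pd c j phi q) (phi q))).
  apply: (@eq_smooth_in _ _ _ _ _ (fun q => wedge (L q) (phi q))) => [q dq|].
    exact/esym/div1_dwedge_self.
  exact: smooth_in_wedge.
rewrite (laplacian_div1 sdE dp); apply: eq_div1 => // j q dq.
rewrite (eq_pd _ div1_dwedge_self dq).
exact: (pd_bilinear j (@wedge_bil_continuous R N) sL sphi dq).
Qed.

End SphereValued.
End Divergence.

(** * The two forms of the conservation law in every chart *)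

Theorem lemma2p2 (R : realType) (m n : nat) (M : riemannian_manifold R m)
    (delta1 delta2 : R) (phi : M -> 'rV[R]_n.+1) :
  smooth_map phi ->
  (forall p : M, dotv (phi p) (phi p) = 1) ->
  (forall (c : atlas M) (p : M), dom c p ->
     let Lphi := laplacian c phi in
     let e := sqnorm_d c phi in
     delta2 *: (laplacian c Lphi p
                + (dotv (Lphi p) (Lphi p)
                   + laplacian c (e : M -> R^o) p
                   + 2 * inner_d c phi Lphi p
                   + 2 * e p ^+ 2) *: phi p
                + 2 *: div1 c (fun j q => e q *: pd c j phi q) p)
     = delta1 *: (Lphi p + e p *: phi p)) ->
  (forall (c : atlas M) (p : M), dom c p ->
     let Lphi := laplacian c phi in
     let e := sqnorm_d c phi in
     div1 c (fun j q =>
       delta2 *: (wedge (pd c j Lphi q) (phi q)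
                  - wedge (Lphi q) (pd c j phi q)
                  + (2 * e q) *: wedge (pd c j phi q) (phi q))
       - delta1 *: wedge (pd c j phi q) (phi q)) p = 0)
  /\
  (delta2 != 0 ->
   forall (c : atlas M) (p : M), dom c p ->
     let Lphi := laplacian c phi in
     let e := sqnorm_d c phi in
     laplacian c (div1 c (fun j q => wedge (pd c j phi q) (phi q))) p
     = div1 c (fun j q =>
         2 *: wedge (Lphi q) (pd c j phi q)
         - (2 * e q) *: wedge (pd c j phi q) (phi q)
         + (delta1 / delta2) *: wedge (pd c j phi q) (phi q)) p).
Proof.
move=> sphi _ phi_eq.
have se c : smooth_in c (sqnorm_d c phi : M -> R^o).
  exact: (smooth_in_sqnorm_d (sphi c)).
(* Here [s] is the long bracket multiplying phi on the left of the equation and [t] is |dphi|^2;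
   unification with [phi_eq] supplies both. *)
have eqn c p : dom c p -> exists s t : R,
    delta2 *: (laplacian c (laplacian c phi) p + s *: phi p
               + 2 *: div1 c (fun j q => sqnorm_d c phi q *: pd c j phi q) p)
    = delta1 *: (laplacian c phi p + t *: phi p).
  by move=> dp; do 2 eexists; exact: phi_eq dp.
split=> [c p dp|d20 c p dp].
  exact: (conservation_law (sphi c) (se c) (eqn c) dp).
exact: (conservation_law_laplacian (sphi c) (se c) (eqn c) d20 dp).
Qed.
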